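(* Let $J$ be a symplectic matrix for an odd symplectic space of dimension $n|n$, and let $$J=\begin{pmatrix} J_{00} & J_{01}\\ J_{10} & J_{11}\end{pmatrix}$$ be its standard block decomposition (so $J_{00}$ is the even-even block). Then $$\operatorname{Ber} J=(\det J_{00})^2 .$$
   Context: Matrices are even supermatrices of format $n|n$ with entries in a supercommutative ($\mathbb{Z}_2$-graded commutative) algebra, e.g. a Grassmann algebra or an algebra of functions on a supermanifold: the $n\times n$ blocks $J_{00},J_{11}$ have even entries and the $n\times n$ blocks $J_{01},J_{10}$ have odd entries. An odd symplectic space is a $\mathbb{Z}_2$-graded vector space $V=V_0\oplus V_1$ (even and odd parts) with an odd non-degenerate antisymmetric bilinear form; necessarily $\dim V=n|n$. In a suitable basis the matrix of the form is $B=\begin{pmatrix}0&1\\1&0\end{pmatrix}$ with $n\times n$ identity blocks. A matrix $J$ is called symplectic (for the odd form) if it preserves the form, i.e. $JBJ^{T}=B$, where the matrix transpose takes into account the parities of the blocks: $$\begin{pmatrix} J_{00} & J_{01}\\ J_{10} & J_{11}\end{pmatrix}^{T}=\begin{pmatrix} J_{00}^{T} & J_{10}^{T}\\ -J_{01}^{T} & J_{11}^{T}\end{pmatrix},$$ the superscript $T$ on individual blocks being the usual transpose of rectangular arrays. $\operatorname{Ber}$ is the Berezinian (superdeterminant): $\operatorname{Ber}J=\det J_{00}\big/\det\bigl(J_{11}-J_{10}J_{00}^{-1}J_{01}\bigr)$. *)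

(* Defs.v *)
From HB Require Import structures.
From mathcomp Require Import all_boot all_order all_algebra.

Set Implicit Arguments.
Unset Strict Implicit.
Unset Printing Implicit Defensive.

Import GRing.Theory.
Local Open Scope ring_scope.

(* [parity false] is the even part and [parity true] the odd part, so that    *)
(* addition of parities is [addb] and the Koszul sign is (-1) ^+ (i && j).    *)
(* [sqr_odd] follows from [supercomm] as soon as 2 is invertible; it is the   *)
(* usual supplement to the sign rule in characteristic 2.  A is a             *)
(* [unitAlgType] only so that x^-1 and x / y denote inverses and quotients.   *)
HB.mixin Record UnitAlgebra_isSuperCom (k : fieldType) A
    of GRing.UnitAlgebra k A := {
  parity : bool -> {pred A};
  parity_submod : forall i, submod_closed (parity i);
  parity_decomp : forall a : A, exists a0 a1 : A,
    [/\ a0 \in parity false, a1 \in parity true & a = a0 + a1];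
  parity_direct : forall a : A,
    a \in parity false -> a \in parity true -> a = 0;
  parity1 : (1 : A) \in parity false;
  parityM : forall i j (a b : A),
    a \in parity i -> b \in parity j -> a * b \in parity (i (+) j);
  supercomm : forall i j (a b : A),
    a \in parity i -> b \in parity j -> a * b = (-1) ^+ (i && j) * (b * a);
  sqr_odd : forall a : A, a \in parity true -> a * a = 0
}.

#[short(type="superComAlgType")]
HB.structure Definition SuperComAlgebra (k : fieldType) :=
  { A of UnitAlgebra_isSuperCom k A & GRing.UnitAlgebra k A }.

Section EvenPart.
Variables (k : fieldType) (A : superComAlgType k).

Definition even_elt : {pred A} := parity false.

Lemma even_elt_divring_closed : divring_closed even_elt.
Proof.
have [_ linP] := @parity_submod k A false.
have addP (x y : A) : x \in even_elt -> y \in even_elt -> x - y \in even_elt.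
  by move=> xe ye; rewrite addrC -scaleN1r; apply: linP.
split=> [| // | x y xe ye]; first exact: parity1.
apply: (@parityM _ _ false false) => //.
have [yU | yNU] := boolP (y \is a GRing.unit); last by rewrite invr_out.
have [b0 [b1 [b0e b1o yVE]]] := parity_decomp y^-1.
have yb1_odd : y * b1 \in parity true by apply: parityM ye b1o.
have yb1_even : y * b1 \in parity false.
  have -> : y * b1 = 1 - y * b0 by rewrite -(divrr yU) yVE mulrDr addrC addKr.
  by apply: addP; [exact: parity1 | exact: parityM ye b0e].
have b1_0 : b1 = 0.
  by rewrite -[b1](mulKr yU) (parity_direct _ yb1_even yb1_odd) mulr0.
by rewrite yVE b1_0 addr0.
Qed.

HB.instance Definition _ :=
  GRing.isDivringClosed.Build A even_elt even_elt_divring_closed.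

(* The even part A_0 as a commutative ring, in which the library's [unitmx]   *)
(* and [invmx] apply.                                                         *)
Record even_type := EvenElt {
  even_val :> A;
  even_valP : even_val \in even_elt
}.

HB.instance Definition _ := [isSub for even_val].
HB.instance Definition _ := [Choice of even_type by <:].
HB.instance Definition _ := [SubChoice_isSubNzRing of even_type by <:].

Lemma even_mulrC : commutative (@GRing.mul even_type).
Proof.
move=> x y; apply: val_inj; rewrite !rmorphM /=.
by rewrite (supercomm false false _ _ (even_valP x) (even_valP y)) expr0 mul1r.
Qed.

HB.instance Definition _ :=
  GRing.PzRing_hasCommutativeMul.Build even_type even_mulrC.
HB.instance Definition _ := [SubNzRing_isSubUnitRing of even_type by <:].

(* The inverse image of a under A_0 -> A; meaningful only for even a.         *)
Definition to_even (a : A) : even_type := insubd 0 a.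

End EvenPart.

Section SuperMatrix.
Variables (k : fieldType) (A : superComAlgType k).

Definition mx_parity (i : bool) (m n : nat) (M : 'M[A]_(m, n)) : Prop :=
  forall r c, M r c \in parity i.

Definition even_supermx (p q : nat) (J : 'M[A]_(p + q)) : Prop :=
  [/\ mx_parity false (ulsubmx J), mx_parity true (ursubmx J),
      mx_parity true (dlsubmx J) & mx_parity false (drsubmx J)].

Definition supertr (p q : nat) (J : 'M[A]_(p + q)) : 'M[A]_(p + q) :=
  block_mx (ulsubmx J)^T      (dlsubmx J)^T
           (- (ursubmx J)^T)  (drsubmx J)^T.

Definition odd_form (n : nat) : 'M[A]_(n + n) := block_mx 0 1%:M 1%:M 0.

Definition odd_symplectic (n : nat) (J : 'M[A]_(n + n)) : Prop :=
  even_supermx J /\ J *m odd_form n *m supertr J = odd_form n.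

Definition even_mx (n : nat) (M : 'M[A]_n) : 'M[even_type A]_n :=
  map_mx (@to_even k A) M.

(* The inverse, over A, of a square matrix with even entries.                 *)
Definition even_invmx (n : nat) (M : 'M[A]_n) : 'M[A]_n :=
  map_mx val (invmx (even_mx M)).

Definition Schur (p q : nat) (J : 'M[A]_(p + q)) : 'M[A]_q :=
  drsubmx J - dlsubmx J *m even_invmx (ulsubmx J) *m ursubmx J.

(* [Ber] is total; its value is the Berezinian exactly when [Ber_defined].    *)
Definition Ber_defined (p q : nat) (J : 'M[A]_(p + q)) : Prop :=
  even_mx (ulsubmx J) \in unitmx /\ \det (Schur J) \is a GRing.unit.

Definition Ber (p q : nat) (J : 'M[A]_(p + q)) : A :=
  \det (ulsubmx J) / \det (Schur J).

End SuperMatrix.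

(* Main.v *)
Require Import Defs.
From mathcomp Require Import all_boot all_order all_algebra.
Import GRing.Theory.
Local Open Scope ring_scope.

(** Write [a b; c d] for the blocks of [J].  The equation [J B J^T = B] is
    equivalent to four block equations, of which three matter here:
      [b a^T = a b^T],  [a d^T + b c^T = 1]  and  [d a^T - c b^T = 1].
    If [a] is invertible, the first one reads [a^-1 b = b^T (a^-1)^T], and then
    the third one computes the Schur complement:
      [d - c a^-1 b = (d a^T - c b^T) (a^-1)^T = (a^-1)^T].
    Hence its determinant is [(det a)^-1] and [Ber J = (det a)^2]
    ([Schur_odd_symplectic]).

    That [a] is invertible follows from the second equation, since [b c^T] has
    nilpotent entries: modulo nilpotents, [det a * det d = det (1 - b c^T)] is
    [1].  The argument ([odd_symplectic_unitmx]) takes place in the even part of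
    the algebra, and uses the Jacobson radical instead of the nilradical: both
    contain the products of two odd elements, but the former, described as the
    set of [x] with all [1 + y x] invertible, is closed under sums without any
    binomial expansion. *)

(** * The Jacobson radical of a commutative ring *)

Section JacobsonRadical.
Set Implicit Arguments.
Unset Strict Implicit.
Variable R : comUnitRingType.

Definition in_jacobson (x : R) : Prop :=
  forall y, 1 + y * x \is a GRing.unit.

Lemma in_jacobson0 : in_jacobson 0.
Proof. by move=> y; rewrite mulr0 addr0 unitr1. Qed.

Lemma in_jacobsonMl z x : in_jacobson x -> in_jacobson (z * x).
Proof. by move=> xJ y; rewrite mulrA. Qed.

(** With [u = 1 + y x] invertible, [1 + y (x + x') = u (1 + u^-1 y x')]. *)
Lemma in_jacobsonD x x' :
  in_jacobson x -> in_jacobson x' -> in_jacobson (x + x').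
Proof.
move=> xJ x'J y; have uU := xJ y.
have -> : 1 + y * (x + x') =
          (1 + y * x) * (1 + (1 + y * x)^-1 * y * x').
  by rewrite [RHS]mulrDr mulr1 -mulrA mulVKr // mulrDr addrA.
by rewrite unitrM uU x'J.
Qed.

Lemma in_jacobson_sqr0 x : x * x = 0 -> in_jacobson x.
Proof.
move=> x2 y; apply/unitrPr; exists (1 - y * x).
have yx2 : (y * x) * (y * x) = 0 by rewrite mulrACA x2 mulr0.
by rewrite mulrBr mulr1 mulrDl mul1r yx2 addr0 addrK.
Qed.

(** The determinant is polynomial in the entries, so it respects congruence
    modulo an ideal: here [det (1 + M)] is congruent to [det 1 = 1]. *)
Lemma unitmx_1D_jacobson n (M : 'M[R]_n) :
  (forall i j, in_jacobson (M i j)) -> 1%:M + M \in unitmx.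
Proof.
move=> MJ; pose cong (x y : R) := in_jacobson (x - y).
have congD x x' y y' : cong x x' -> cong y y' -> cong (x + y) (x' + y').
  by move=> xJ yJ; rewrite /cong opprD addrACA; apply: in_jacobsonD.
have congM x x' y y' : cong x x' -> cong y y' -> cong (x * y) (x' * y').
  move=> xJ yJ; rewrite /cong.
  have -> : x * y - x' * y' = y * (x - x') + x' * (y - y').
    by rewrite !mulrBr [y * x]mulrC [y * x']mulrC addrA subrK.
  by apply: in_jacobsonD; apply: in_jacobsonMl.
have congxx x : cong x x by rewrite /cong subrr; apply: in_jacobson0.
have : cong (\det (1%:M + M)) (\det (1%:M : 'M[R]_n)).
  rewrite /determinant; apply: (big_ind2 cong) => [||s _].
  - exact: congxx.
  - exact: congD.
  apply: (congM); first exact: congxx.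
  apply: (big_ind2 cong) => [||i _].
  - exact: congxx.
  - exact: congM.
  by rewrite /cong [fun_of_matrix (_ + _) _ _]mxE addrAC subrr add0r; apply: MJ.
by rewrite det1 unitmxE => /(_ 1); rewrite mul1r addrC subrK.
Qed.

Lemma unitmx_mul_1B_jacobson n (M P N : 'M[R]_n) :
  (forall i j, in_jacobson (N i j)) -> M *m P = 1%:M - N -> M \in unitmx.
Proof.
move=> NJ MP; have : M *m P \in unitmx; last by rewrite unitmx_mul => /andP[].
rewrite MP; apply: unitmx_1D_jacobson => i j.
by rewrite mxE -mulN1r; apply: in_jacobsonMl.
Qed.

End JacobsonRadical.

(** * Even matrices over a supercommutative algebra *)

Section OddSymplectic.
Set Implicit Arguments.
Unset Strict Implicit.
Variables (k : fieldType) (A : superComAlgType k).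

Local Notation val_mx := (map_mx (val : even_type A -> A)).

Lemma to_evenK (x : A) : x \in parity false -> val (to_even x) = x.
Proof. by move=> xe; rewrite /to_even insubdK. Qed.

Lemma val_mx_inj m n : injective (val_mx : 'M_(m, n) -> 'M_(m, n)).
Proof.
move=> M N /matrixP eqMN; apply/matrixP=> i j; apply: val_inj.
by have := eqMN i j; rewrite !mxE.
Qed.

Lemma even_mxK n (M : 'M[A]_n) :
  mx_parity false M -> val_mx (even_mx M) = M.
Proof. by move=> Me; apply/matrixP=> i j; rewrite !mxE to_evenK. Qed.

(** Two odd factors anticommute, so [(p q) (p q) = - (p p) (q q) = 0]. *)
Lemma in_jacobson_odd_mul (p q : A) : p \in parity true -> q \in parity true ->
  in_jacobson (to_even (p * q)).
Proof.
move=> po qo; apply: in_jacobson_sqr0; apply: val_inj.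
have pqe : p * q \in parity false by apply: (parityM true true).
rewrite rmorphM rmorph0 /= to_evenK //.
rewrite -mulrA [q * _]mulrA (supercomm _ _ _ _ qo po) expr1 mulN1r mulNr mulrN.
by rewrite -(mulrA p q q) (sqr_odd _ qo) !mulr0 oppr0.
Qed.

(** Used for [b c^T].  The matrix is lifted to the even part because [A] itself
    is not commutative, so that determinants over [A] do not detect
    invertibility. *)
Lemma mulmx_odd_jacobson m n (P : 'M[A]_(m, n)) (Q : 'M[A]_(n, m)) :
  mx_parity true P -> mx_parity true Q ->
  exists2 N : 'M[even_type A]_m,
    forall i j, in_jacobson (N i j) & val_mx N = P *m Q.
Proof.
move=> Po Qo; exists (\matrix_(i, j) \sum_l to_even (P i l * Q l j)).
  move=> i j; rewrite mxE; apply: big_ind => [|x y|l _].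
  - exact: in_jacobson0.
  - exact: in_jacobsonD.
  - exact: in_jacobson_odd_mul.
apply/matrixP=> i j; rewrite !mxE rmorph_sum; apply: eq_bigr => l _ /=.
by rewrite to_evenK //; apply: (parityM true true).
Qed.

(** * Odd symplectic matrices *)

Lemma odd_symplectic_blocks n (J : 'M[A]_(n + n)) : odd_symplectic J ->
  let a := ulsubmx J in let b := ursubmx J in
  let c := dlsubmx J in let d := drsubmx J in
  [/\ b *m a^T = a *m b^T, a *m d^T + b *m c^T = 1%:M
    & d *m a^T - c *m b^T = 1%:M].
Proof.
move=> [_]; rewrite /supertr -{1}[J]submxK /odd_form !mulmx_block.
rewrite !mulmx0 !mulmx1 !add0r !addr0 !mulmxN => /eq_block_mx[eq00 eq01 eq10 _].
by split=> //; [apply/eqP; rewrite -subr_eq0 eq00 | rewrite addrC].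
Qed.

(** [a d^T = 1 - b c^T] is invertible because [b c^T] is a product of odd
    matrices; over a commutative ring, so is the factor [a]. *)
Lemma odd_symplectic_unitmx n (J : 'M[A]_(n + n)) : odd_symplectic J ->
  even_mx (ulsubmx J) \in unitmx.
Proof.
move=> symJ; have [_ eq01 _] := odd_symplectic_blocks symJ.
have [[ae bo co de] _] := symJ.
have cTo : mx_parity true (dlsubmx J)^T by move=> i j; rewrite mxE.
have [N NJ NE] := mulmx_odd_jacobson bo cTo.
apply: (unitmx_mul_1B_jacobson (P := (even_mx (drsubmx J))^T) NJ).
apply: val_mx_inj.
rewrite map_mxM map_mxB NE map_mx1 -map_trmx !even_mxK //.
by rewrite -eq01 addrK.
Qed.

(** [d - c a^-1 b = d - c b^T (a^-1)^T = (d a^T - c b^T) (a^-1)^T], using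
    [a^-1 b = b^T (a^-1)^T]. *)
Lemma Schur_odd_symplectic n (J : 'M[A]_(n + n)) : odd_symplectic J ->
  Defs.Schur J = (even_invmx (ulsubmx J))^T.
Proof.
move=> symJ; have [eq00 _ eq10] := odd_symplectic_blocks symJ.
have aU := odd_symplectic_unitmx symJ; have [[ae _ _ _] _] := symJ.
set a := ulsubmx J in eq00 eq10 aU ae *; set a1 := even_invmx a.
have a1K : a1 *m a = 1%:M.
  by rewrite -[a in _ *m a]even_mxK // -map_mxM mulVmx // map_mx1.
(* The transpose reverses products only over a commutative ring, whence the
   detour through the even part. *)
have aTK : a^T *m a1^T = 1%:M.
  rewrite -[a in a^T]even_mxK // !(map_trmx val) -map_mxM -trmx_mul mulVmx //.
  by rewrite trmx1 map_mx1.
have a1b : a1 *m ursubmx J = (ursubmx J)^T *m a1^T.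
  rewrite -[ursubmx J in LHS]mulmx1 -aTK (mulmxA (ursubmx J)) eq00 !mulmxA.
  by rewrite a1K mul1mx.
rewrite /Defs.Schur -/a -/a1 -mulmxA a1b -[drsubmx J]mulmx1 -aTK !mulmxA -mulmxBl.
by rewrite eq10 mul1mx.
Qed.

End OddSymplectic.

Theorem theorem3 (k : fieldType) (A : superComAlgType k) (n : nat)
    (J : 'M[A]_(n + n)) :
  odd_symplectic J -> Ber_defined J /\ Ber J = (\det (ulsubmx J)) ^+ 2.
Proof.
move=> symJ; have [[ae _ _ _] _] := symJ.
have aU := odd_symplectic_unitmx symJ.
have detS : \det (Defs.Schur J) = val (\det (even_mx (ulsubmx J)))^-1.
  by rewrite Schur_odd_symplectic // map_trmx det_map_mx det_tr det_inv.
have detU : \det (even_mx (ulsubmx J)) \is a GRing.unit by rewrite -unitmxE.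
have detE : \det (ulsubmx J) = val (\det (even_mx (ulsubmx J))).
  by rewrite -det_map_mx even_mxK.
rewrite /Ber_defined /Ber detS detE; split.
  by split=> //; rewrite rmorph_unit ?unitrV.
by rewrite rmorphV // invrK expr2.
Qed.
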